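(* Let $X$ and $Y$ be compact metric spaces with metrics $d_X$ and $d_Y$ respectively, and let $K$ and $M$ be compact Hausdorff spaces. If $T$ is a homomorphism from $\operatorname{Lip}(X, C(K))$ into $\operatorname{Lip}(Y, C(M))$, then there exist a clopen subset $\mathcal{D}$ of $Y \times M$ and two continuous mappings $\varphi : \mathcal{D} \to X$ and $\psi : \mathcal{D} \to K$ satisfying (i) and (ii) below such that $T$ has the form $$(\ast)\qquad (Tf)(y,\eta) = \begin{cases} f\bigl(\varphi(y,\eta), \psi(y,\eta)\bigr) & \text{if } (y,\eta) \in \mathcal{D}, \\ 0 & \text{if } (y,\eta) \in (Y \times M) \setminus \mathcal{D}, \end{cases}$$ for all $f \in \operatorname{Lip}(X, C(K))$. (i) There exists $L \ge 0$ such that whenever $(y,\eta), (y',\eta) \in \mathcal{D}$ and $y \ne y'$, one has $$\frac{d_X(\varphi(y,\eta), \varphi(y',\eta))}{d_Y(y,y')} \le L.$$ (ii) There is a constant $r > 0$, independent of $\eta$, such that for every $\eta \in M$ the set $\mathcal{D}^{\eta} = \{ y \in Y : (y,\eta) \in \mathcal{D} \}$ is a union of finitely many disjoint clopen subsets $V^{\eta}_1, \ldots, V^{\eta}_{n_\eta}$ of $Y$ such that the map $y \mapsto \psi(y,\eta)$ is constant on $V^{\eta}_i$ for each $i = 1, \ldots, n_\eta$, and $d_Y(V^{\eta}_i, V^{\eta}_j) \ge r$ for all $i \ne j$. Conversely, if a clopen subset $\mathcal{D}$ of $Y \times M$ and continuous mappings $\varphi : \mathcal{D} \to X$, $\psi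 : \mathcal{D} \to K$ satisfying (i) and (ii) are given, then $T$ defined by $(\ast)$ is a homomorphism from $\operatorname{Lip}(X, C(K))$ into $\operatorname{Lip}(Y, C(M))$. Moreover, $T$ is unital if and only if $\mathcal{D} = Y \times M$.
   Context: For a compact Hausdorff space $K$, $C(K)$ is the Banach algebra of complex-valued continuous functions on $K$ with the supremum norm. For a compact metric space $X$, $\operatorname{Lip}(X, C(K))$ is the Banach algebra (pointwise operations) of all functions $f : X \to C(K)$ with $\mathcal{L}_{X,C(K)}(f) = \sup_{x \ne x'} \|f(x) - f(x')\|_{C(K)} / d_X(x,x') < \infty$, with norm $\|f\| = \sup_{x \in X} \|f(x)\|_{C(K)} + \mathcal{L}_{X,C(K)}(f)$. An element $f \in \operatorname{Lip}(X, C(K))$ is regarded as a function on $X \times K$ via $f(x,\xi) = [f(x)](\xi)$; similarly for $\operatorname{Lip}(Y, C(M))$. A homomorphism between Banach algebras is a map preserving addition, scalar multiplication and multiplication (continuity is not assumed); it is unital if it maps the unit to the unit. A set is clopen if it is both open and closed; clopen sets may be empty, and statements about an empty set are regarded as true. For $A, B \subset Y$, $d_Y(A,B) = \inf\{ d_Y(y,y') : y \in A,\ y' \in B \}$, with $d_Y(A,B) = \infty$ if $A$ or $B$ is empty. *)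

(* Defs.v *)
From HB Require Import structures.
From mathcomp Require Import all_boot all_order all_algebra.
From mathcomp Require Import complex.
From mathcomp Require Import all_classical all_reals all_analysis.

Set Implicit Arguments.
Unset Strict Implicit.
Unset Printing Implicit Defensive.

Import Order.TTheory GRing.Theory Num.Theory.
Import numFieldNormedType.Exports.
Local Open Scope classical_set_scope.
Local Open Scope ring_scope.

(* [hausdorff_space] and compactness of the whole space are predicates in the
   library; they are bundled here because the algebra structures below depend
   on them.  Spaces may be empty. *)
HB.mixin Record isCompactHausdorff T & Topological T := {
  compact_hausdorff_compact : compact [set: T];
  compact_hausdorff_hausdorff : hausdorff_space T }.

#[short(type="compactHausdorffType")]
HB.structure Definition CompactHausdorff :=
  { T of Topological T & isCompactHausdorff T }.

HB.mixin Record isCompactMetric (R : numDomainType) T & Metric R T := {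
  compact_metric_compact : compact [set: T] }.

#[short(type="compactMetricType")]
HB.structure Definition CompactMetric (R : numDomainType) :=
  { T of Metric R T & isCompactMetric R T }.

(* [R[i]^o] is the complex field with the topology of the modulus. *)
Definition ctsC (R : realType) (K : topologicalType) : Type :=
  continuousType K R[i]^o.

Section ctsC_algebra.
Context {R : realType} {K : topologicalType}.
Local Notation CK := (ctsC R K).
Local Notation toC := (@Continuous.sort K R[i]^o).

HB.instance Definition _ := Choice.copy CK (continuousType K R[i]^o).

Lemma ctsC_ext (f g : CK) : toC f =1 toC g -> f = g.
Proof. by move=> fg; apply/continuousEP. Qed.

Lemma ctsC_cts (f : CK) : continuous (toC f).
Proof. exact: cts_fun. Qed.

Lemma ctsC_add_subproof (f g : CK) : continuous (toC f + toC g : K -> R[i]^o).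
Proof. by move=> x; apply: cvgD; exact: ctsC_cts. Qed.

Lemma ctsC_opp_subproof (f : CK) : continuous (- toC f : K -> R[i]^o).
Proof. by move=> x; apply: cvgN; exact: ctsC_cts. Qed.

Lemma ctsC_mul_subproof (f g : CK) : continuous (toC f * toC g : K -> R[i]^o).
Proof. by move=> x; apply: cvgM; exact: ctsC_cts. Qed.

Lemma ctsC_scale_subproof (a : R[i]) (f : CK) :
  continuous (a *: toC f : K -> R[i]^o).
Proof. by move=> x; apply: cvgZr; exact: ctsC_cts. Qed.

Lemma ctsC_cst_subproof (a : R[i]) : continuous (cst a : K -> R[i]^o).
Proof. by move=> x; exact: cvg_cst. Qed.

Definition ctsC_cst (a : R[i]) : CK := mkcts (@ctsC_cst_subproof a).
Definition ctsC_add (f g : CK) : CK := mkcts (@ctsC_add_subproof f g).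
Definition ctsC_opp (f : CK) : CK := mkcts (@ctsC_opp_subproof f).
Definition ctsC_mul (f g : CK) : CK := mkcts (@ctsC_mul_subproof f g).
Definition ctsC_scale (a : R[i]) (f : CK) : CK :=
  mkcts (@ctsC_scale_subproof a f).

Lemma ctsC_addA : associative ctsC_add.
Proof. by move=> f g h; apply: ctsC_ext => x; exact: addrA. Qed.
Lemma ctsC_addC : commutative ctsC_add.
Proof. by move=> f g; apply: ctsC_ext => x; exact: addrC. Qed.
Lemma ctsC_add0 : left_id (ctsC_cst 0) ctsC_add.
Proof. by move=> f; apply: ctsC_ext => x; exact: add0r. Qed.
Lemma ctsC_addN : left_inverse (ctsC_cst 0) ctsC_opp ctsC_add.
Proof. by move=> f; apply: ctsC_ext => x; exact: addNr. Qed.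

HB.instance Definition _ :=
  GRing.isZmodule.Build CK ctsC_addA ctsC_addC ctsC_add0 ctsC_addN.

Lemma ctsC_mulA : associative ctsC_mul.
Proof. by move=> f g h; apply: ctsC_ext => x; exact: mulrA. Qed.
Lemma ctsC_mulC : commutative ctsC_mul.
Proof. by move=> f g; apply: ctsC_ext => x; exact: mulrC. Qed.
Lemma ctsC_mul1 : left_id (ctsC_cst 1) ctsC_mul.
Proof. by move=> f; apply: ctsC_ext => x; exact: mul1r. Qed.
Lemma ctsC_mulD : left_distributive ctsC_mul +%R.
Proof. by move=> f g h; apply: ctsC_ext => x; exact: mulrDl. Qed.

HB.instance Definition _ :=
  GRing.Zmodule_isComPzRing.Build CK ctsC_mulA ctsC_mulC ctsC_mul1 ctsC_mulD.

Lemma ctsC_scaleA (a b : R[i]) (f : CK) :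
  ctsC_scale a (ctsC_scale b f) = ctsC_scale (a * b) f.
Proof. by apply: ctsC_ext => x; exact: mulrA. Qed.
Lemma ctsC_scale1 : left_id 1 ctsC_scale.
Proof. by move=> f; apply: ctsC_ext => x; exact: mul1r. Qed.
Lemma ctsC_scaleDr : right_distributive ctsC_scale +%R.
Proof. by move=> a f g; apply: ctsC_ext => x; exact: mulrDr. Qed.
Lemma ctsC_scaleDl (f : CK) :
  {morph ctsC_scale^~ f : a b / a + b >-> a + b}.
Proof. by move=> a b; apply: ctsC_ext => x; exact: mulrDl. Qed.

HB.instance Definition _ := GRing.Zmodule_isLmodule.Build R[i] CK
  ctsC_scaleA ctsC_scale1 ctsC_scaleDr ctsC_scaleDl.

End ctsC_algebra.

(* The modulus [normc] is the R-valued version of [`|z|]. *)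
Definition supnorm (R : realType) (K : topologicalType) (f : ctsC R K) : R :=
  sup [set Normc.normc (f xi) | xi in [set: K]].

Section supnorm_lemmas.
Context {R : realType} {K : compactHausdorffType}.
Implicit Types f g : ctsC R K.

Lemma normc_norm (z : R[i]) : `|z| = (Normc.normc z)%:C%C.
Proof. by rewrite normc_def; case: z. Qed.

Lemma normc_ge0 (z : R[i]) : 0 <= Normc.normc z.
Proof. by case: z => a b; exact: sqrtr_ge0. Qed.

Lemma normc_dist (z w : R[i]) :
  `|Normc.normc z - Normc.normc w| <= Normc.normc (z - w).
Proof.
rewrite ler_norml lerBlDr lerNl opprB lerBlDr; apply/andP; split.
  rewrite -{1}(subrK z w) -(normcN (z - w)) opprB; exact: le_normcD.
by rewrite -{1}(subrK w z); exact: le_normcD.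
Qed.

Lemma supnorm_has_ubound f :
  has_ubound [set Normc.normc (f xi) | xi in [set: K]].
Proof.
have cf : continuous (fun xi : K => Normc.normc (f xi) : R^o).
  move=> x; apply/cvgrPdist_lt => e e0.
  have e0' : 0 < e%:C%C by rewrite ltcR.
  have /cvgrPdist_lt/(_ _ e0') := @ctsC_cts _ _ f x.
  apply: filterS => t; rewrite normc_norm ltcR.
  by apply: le_lt_trans; exact: normc_dist.
have /compact_bounded :
    compact ((fun xi : K => Normc.normc (f xi) : R^o) @` [set: K]).
  apply: continuous_compact; first exact: continuous_subspaceT.
  exact: compact_hausdorff_compact.
case=> M [_ /(_ (M + 1))]; rewrite ltrDl ltr01 => /(_ isT) MP.
by exists (M + 1) => _ [x _ <-]; apply: le_trans (MP _ _); [exact: ler_norm|exists x].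
Qed.

Lemma le_supnorm f xi : Normc.normc (f xi) <= supnorm f.
Proof. by apply: ub_le_sup; [exact: supnorm_has_ubound|exists xi]. Qed.

Lemma supnorm_le f (a : R) :
  0 <= a -> (forall xi, Normc.normc (f xi) <= a) -> supnorm f <= a.
Proof.
move=> a0 fa; rewrite /supnorm.
have [->|/set0P ne] := eqVneq [set Normc.normc (f xi) | xi in [set: K]] set0.
  by rewrite sup0.
by apply: ge_sup => // _ [x _ <-].
Qed.

Lemma supnorm_ge0 f : 0 <= supnorm f.
Proof.
have [[xi _]|ne] := pselect (exists xi : K, True).
  exact: le_trans (normc_ge0 _) (le_supnorm f xi).
have -> : supnorm f = sup set0; last by rewrite sup0.
by congr sup; rewrite -subset0 => t [x _ _]; apply: ne; exists x.
Qed.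

Lemma supnormD f g : supnorm (f + g) <= supnorm f + supnorm g.
Proof.
apply: supnorm_le => [|x]; first by rewrite addr_ge0 ?supnorm_ge0.
exact: le_trans (le_normcD _ _) (lerD (le_supnorm f x) (le_supnorm g x)).
Qed.

Lemma supnormM f g : supnorm (f * g) <= supnorm f * supnorm g.
Proof.
apply: supnorm_le => [|x]; first by rewrite mulr_ge0 ?supnorm_ge0.
rewrite [X in X <= _](Normc.normcM (f x) (g x)).
by rewrite ler_pM ?normc_ge0 ?le_supnorm.
Qed.

Lemma supnormN f : supnorm (- f) = supnorm f.
Proof.
by rewrite /supnorm; under eq_imagel do rewrite [Normc.normc _]normcN.
Qed.

Lemma supnorm0 : supnorm (0 : ctsC R K) = 0.
Proof.
apply/eqP; rewrite eq_le supnorm_ge0 andbT; apply: supnorm_le => // x.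
by rewrite Normc.normc0.
Qed.

Lemma supnormZ_le (a : R[i]) f : supnorm (a *: f) <= Normc.normc a * supnorm f.
Proof.
apply: supnorm_le => [|x]; first by rewrite mulr_ge0 ?supnorm_ge0 ?normc_ge0.
rewrite [X in X <= _](Normc.normcM a (f x)).
by rewrite ler_wpM2l ?normc_ge0 ?le_supnorm.
Qed.

End supnorm_lemmas.

(* The Lipschitz constant, as an extended real; it is -oo when X has at most
   one point, so that [lip_const f < +oo] then holds. *)
Definition lip_const (R : realType) (X : metricType R) (K : topologicalType)
    (f : X -> ctsC R K) : \bar R :=
  ereal_sup [set (supnorm (f p.1 - f p.2) / mdist p.1 p.2)%:E
            | p in [set p : X * X | p.1 <> p.2]].

Definition lip_pred (R : realType) (X : metricType R) (K : topologicalType)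
  : {pred X -> ctsC R K} := fun f => `[< (lip_const f < +oo)%E >].

Record lip (R : realType) (X : metricType R) (K : topologicalType) := Lip {
  lip_fun :> X -> ctsC R K;
  lip_funP : lip_fun \in @lip_pred R X K }.
Arguments lip_fun {R X K}.

HB.instance Definition _ (R : realType) (X : metricType R)
  (K : topologicalType) := [isSub of lip X K for lip_fun].
HB.instance Definition _ (R : realType) (X : metricType R)
  (K : topologicalType) := [Choice of lip X K by <:].

Section lip_algebra.
Context {R : realType} {X : compactMetricType R} {K : compactHausdorffType}.
Implicit Types f g : X -> ctsC R K.
Local Notation lipP := (@lip_pred R X K).

Lemma lip_predP f : reflect (exists2 L : R, 0 <= L &
  forall x x', supnorm (f x - f x') <= L * mdist x x') (f \in lipP).
Proof.
apply: (iffP (asboolP _)) => [supoo|[L L0 fL]].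
  have [M [M0 ubM]] : exists M : R, 0 <= M /\ (lip_const f <= M%:E)%E.
    move: supoo; case: (lip_const f) => [r _| |_] //.
      by exists (Num.max 0 r); rewrite le_max lexx lee_fin le_max lexx orbT.
    by exists 0; rewrite leNye.
  exists M => // x x'; have [->|xx'] := eqVneq x x'.
    by rewrite subrr supnorm0 mulr_ge0 ?mdist_ge0.
  rewrite -ler_pdivrMr ?mdist_gt0// -lee_fin; apply: le_trans ubM.
  by apply: ereal_sup_ubound; exists (x, x') => //=; exact/eqP.
apply: (@le_lt_trans _ _ L%:E); last exact: ltry.
apply: ge_ereal_sup => _ [[x x'] /= /eqP xx' <-].
by rewrite lee_fin ler_pdivrMr ?mdist_gt0.
Qed.

Lemma lip_bounded f : f \in lipP ->
  exists2 M : R, 0 <= M & forall x, supnorm (f x) <= M.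
Proof.
move=> /lip_predP[L L0 fL].
have [[x0 _]|ne] := pselect (exists x : X, True); last first.
  by exists 0 => // x; case: ne; exists x.
have cd : continuous (fun x : X => mdist x0 x : R^o).
  move=> x; apply/cvgrPdist_lt => e e0.
  have := nbhsx_ballx x e e0; rewrite ballEmdist; apply: filterS => t /=.
  apply: le_lt_trans; rewrite ler_norml lerBlDr lerNl opprB lerBlDr.
  by rewrite {2}(metric_sym x t) ![mdist _ _ + mdist x0 _]addrC !metric_triangle.
have /compact_bounded :
    compact ((fun x : X => mdist x0 x : R^o) @` [set: X]).
  apply: continuous_compact; first exact: continuous_subspaceT.
  exact: compact_metric_compact.
case=> B [_ /(_ (`|B| + 1))].
rewrite (le_lt_trans (ler_norm B)) ?ltrDl ?ltr01// => /(_ isT) BP.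
exists (L * (`|B| + 1) + supnorm (f x0)) => [|x].
  by rewrite addr_ge0 ?supnorm_ge0// mulr_ge0// addr_ge0.
rewrite -{1}(subrK (f x0) (f x)) (le_trans (supnormD _ _))// lerD2r.
apply: le_trans (fL _ _) _; rewrite ler_wpM2l// metric_sym.
by apply: le_trans (BP _ _); [exact: ler_norm|exists x].
Qed.

Lemma lip_subring_closed : subring_closed lipP.
Proof.
split.
- apply/lip_predP; exists 0 => // x x'.
  by rewrite mul0r subrr supnorm0.
- move=> f g /lip_predP[L L0 fL] /lip_predP[L' L'0 gL'].
  apply/lip_predP; exists (L + L') => [|x x']; first exact: addr_ge0.
  have -> : (f - g) x - (f - g) x' = (f x - f x') + - (g x - g x').
    by rewrite !fctE opprD opprK addrACA opprB [- g x + _]addrC.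
  by rewrite mulrDl (le_trans (supnormD _ _))// supnormN lerD.
- move=> f g fl gl; have [A A0 fA] := lip_bounded fl.
  have [B B0 gB] := lip_bounded gl.
  move: fl gl => /lip_predP[L L0 fL] /lip_predP[L' L'0 gL'].
  apply/lip_predP; exists (A * L' + L * B) => [|x x'].
    by rewrite addr_ge0 ?mulr_ge0.
  have -> : (f * g) x - (f * g) x' =
      f x * (g x - g x') + (f x - f x') * g x'.
    by rewrite !fctE mulrBr mulrBl addrA subrK.
  rewrite [X in _ <= X]mulrDl (le_trans (supnormD _ _))// lerD//.
    rewrite -mulrA (le_trans (supnormM _ _))// ler_pM ?supnorm_ge0//.
  by rewrite mulrAC (le_trans (supnormM _ _))// ler_pM ?supnorm_ge0.
Qed.

Lemma lip_scaler_closed : GRing.scaler_closed lipP.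
Proof.
move=> a f /lip_predP[L L0 fL]; apply/lip_predP.
exists (Normc.normc a * L) => [|x x']; first by rewrite mulr_ge0 ?normc_ge0.
rewrite !fctE -scalerBr (le_trans (supnormZ_le _ _))// -mulrA.
by rewrite ler_wpM2l ?normc_ge0.
Qed.

HB.instance Definition _ := GRing.isSubringClosed.Build _ lipP lip_subring_closed.
HB.instance Definition _ := GRing.isScaleClosed.Build _ _ lipP lip_scaler_closed.
HB.instance Definition _ := GRing.SubChoice_isSubComPzRing.Build _ lipP
  (lip X K) lip_subring_closed.
HB.instance Definition _ := [SubZmodule_isSubLmodule of lip X K by <:].

End lip_algebra.

Section lip_homomorphisms.
Context {R : realType} {X Y : compactMetricType R}
        {K M : compactHausdorffType}.
Implicit Types (T : lip X K -> lip Y M) (D : set (Y * M)).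

Definition lip_hom T : Prop :=
  [/\ {morph T : f g / f + g >-> f + g}, scalable T &
      {morph T : f g / f * g >-> f * g}].

Definition lip_unital T : Prop := T 1 = 1.

(* Maps on D are functions on the subtype [set_type D], with its subspace
   topology, rather than total functions on Y * M, since X or K may be empty. *)
Definition lip_form D (phi : D -> X) (psi : D -> K) T : Prop :=
  forall f : lip X K,
    (forall z : D, T f (\val z).1 (\val z).2 = f (phi z) (psi z)) /\
    (forall y eta, ~ D (y, eta) -> T f y eta = 0).

Definition equilipschitz D (phi : D -> X) : Prop :=
  exists2 L : R, 0 <= L & forall z z' : D,
    (\val z).2 = (\val z').2 -> (\val z).1 <> (\val z').1 ->
    mdist (phi z) (phi z') / mdist (\val z).1 (\val z').1 <= L.

Definition set_dist (A B : set Y) : \bar R :=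
  ereal_inf [set (mdist p.1 p.2)%:E | p in A `*` B].

Definition piecewise_constant D (psi : D -> K) : Prop :=
  exists2 r : R, 0 < r & forall eta : M,
    exists (n : nat) (V : 'I_n -> set Y),
      [/\ [set y | D (y, eta)] = \bigcup_i V i,
          forall i, clopen (V i),
          forall i j, i != j -> V i `&` V j = set0,
          forall i (z z' : D), (\val z).2 = eta -> (\val z').2 = eta ->
            V i (\val z).1 -> V i (\val z').1 -> psi z = psi z' &
          forall i j, i != j -> (r%:E <= set_dist (V i) (V j))%E].

End lip_homomorphisms.

(* Main.v *)
Require Import Defs.
From mathcomp Require Import all_boot all_order all_algebra.
From mathcomp Require Import complex.
From mathcomp Require Import all_classical all_reals all_analysis.
From mathcomp Require Import ring lra.
Import Order.TTheory GRing.Theory Num.Theory.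
Import numFieldNormedType.Exports.
Local Open Scope classical_set_scope.
Local Open Scope ring_scope.

Set Implicit Arguments.
Unset Strict Implicit.
Unset Printing Implicit Defensive.

(** Why the theorem holds.

    For fixed (y, eta), f |-> T f y eta is a multiplicative linear functional on
    Lip(X, C(K)).  Such a functional chi is zero or a point evaluation: the zero
    sets of the elements of ker chi are nonempty, since an element without
    zeros is invertible, and they are stable under intersection up to
    shrinking, since f^* f + g^* g vanishes only where f and g both do; by
    compactness of X * K they have a common point, and chi is evaluation there
    ([character_eval]).  Hence T f is f composed with (phi, psi) on the set D
    where the idempotent T 1 equals 1, and 0 elsewhere ([lip_hom_form]).  D is
    clopen because T 1 is continuous with values 0 and 1, while phi and psi are
    continuous because their compositions with distance functions, resp. with
    Urysohn functions, are values of T ([lip_form_continuous]).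

    Conditions (i) and (ii) are two instances of one uniform boundedness
    principle ([uniform_boundedness]).  For a fixed f, the function T f is
    Lipschitz, so the oscillation of f between the images of (y, eta) and
    (y', eta) is at most a constant times d(y, y'), the constant depending on f.
    A gliding hump makes the constant uniform over a bounded convex set of
    real functions that is stable under uniform limits.  Applied to the
    1-Lipschitz functions on X, whose largest oscillation between two points is
    their distance, it gives (i).  Applied to the continuous functions from K
    to [0, 1], whose largest oscillation between distinct points is 1, it gives
    r > 0 such that psi(y, eta) = psi(y', eta) as soon as d(y, y') < r.  By
    compactness of Y this is equivalent to (ii): the pieces are the level sets
    of psi(., eta) ([piecewise_constantP]).

    Conversely, a compactness argument yields d > 0 such that moving y by less
    than d does not change the membership of (y, eta) in D ([clopen_uniform]).
    Two points y, y' closer than both r and d then see the same value of psi,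
    so f o (phi, psi), extended by 0, is Lipschitz at small scale by (i), and at
    large scale because it is bounded ([lip_form_exists]). *)

(** * Complex-valued continuous and Lipschitz functions *)

Local Notation normc := Normc.normc.

Lemma cvgC_distP (R : realType) (T : Type) (F : set_system T) (FF : Filter F)
    (f : T -> R[i]^o) (l : R[i]) :
  f @ F --> (l : R[i]^o) <->
  forall e : R, 0 < e -> \forall t \near F, normc (l - f t) < e.
Proof.
split=> [/cvgrPdist_lt fl e e0|fl].
  have e0' : 0 < e%:C%C by rewrite ltcR.
  by apply: filterS (fl _ e0') => t; rewrite normc_norm ltcR.
(* the radius ranges over R[i], where being positive entails being real *)
apply/cvgrPdist_lt => -[e e'] e0.
have e'0 : e' = 0 by move: e0; rewrite ltcE /= => /andP[/eqP].
have {}e0 : 0 < e by move: e0; rewrite ltcE /= => /andP[].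
by apply: filterS (fl _ e0) => t; rewrite e'0 normc_norm ltcR.
Qed.

Lemma cts_normcP (R : realType) (T : topologicalType) (f : T -> R[i]) :
  continuous (f : T -> R[i]^o) <->
  forall (x : T) (e : R), 0 < e -> \forall y \near x, normc (f x - f y) < e.
Proof. by split=> cf x; apply/cvgC_distP; exact: cf. Qed.

Lemma normc_gt0 (R : realType) (z : R[i]) : (0 < normc z) = (z != 0).
Proof.
rewrite lt_neqAle normc_ge0 andbT eq_sym; congr (~~ _).
by apply/eqP/eqP => [|->]; [exact: Normc.eq0_normc | exact: Normc.normc0].
Qed.

Lemma normc_real (R : realType) (a : R) : normc a%:C%C = `|a|.
Proof. by rewrite /= expr0n addr0 sqrtr_sqr. Qed.

Lemma normc_conj (R : realType) (z : R[i]) : normc z^*%C = normc z.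
Proof. by case: z => a b; rewrite /= sqrrN. Qed.

Section lip_elements.
Context {R : realType} {X : compactMetricType R} {K : compactHausdorffType}.
Implicit Types f g : lip X K.

Lemma lip_ext f g : (forall x xi, f x xi = g x xi) -> f = g.
Proof.
move=> fg; apply: val_inj; apply/funext => x.
by apply: ctsC_ext => xi; exact: fg.
Qed.

Lemma lip_addE f g x xi : (f + g) x xi = f x xi + g x xi.
Proof. by []. Qed.

Lemma lip_mulE f g x xi : (f * g) x xi = f x xi * g x xi.
Proof. by []. Qed.

Lemma lip_scaleE a f x xi : (a *: f) x xi = a * f x xi.
Proof. by []. Qed.

Lemma lip_oneE x xi : (1 : lip X K) x xi = 1.
Proof. by []. Qed.

Lemma lip_lipschitz f : exists2 L : R, 0 <= L &
  forall x x' xi, normc (f x xi - f x' xi) <= L * mdist x x'.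
Proof.
have /lip_predP[L L0 fL] := lip_funP f.
exists L => // x x' xi; apply: le_trans (fL x x').
exact: (le_supnorm (f x - f x')).
Qed.

Lemma lip_bound f : exists2 B : R, 0 <= B &
  forall x xi, normc (f x xi) <= B.
Proof.
have [B B0 fB] := lip_bounded (lip_funP f).
by exists B => // x xi; apply: le_trans (fB x); exact: le_supnorm.
Qed.

Lemma lip_build (F : X -> K -> R[i]) (L : R) : 0 <= L ->
  (forall x, continuous (F x : K -> R[i]^o)) ->
  (forall x x' xi, normc (F x xi - F x' xi) <= L * mdist x x') ->
  exists f : lip X K, forall x xi, f x xi = F x xi.
Proof.
move=> L0 cF FL.
pose f x : ctsC R K := mkcts (cF x).
have fP : f \in @lip_pred R X K.
  apply/lip_predP; exists L => // x x'.
  by apply: supnorm_le => [|xi]; [rewrite mulr_ge0 ?mdist_ge0 | exact: FL].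
by exists (Lip fP).
Qed.

Lemma nbhs_mdist_lt (x : X) (e : R) : 0 < e -> \forall y \near x, mdist x y < e.
Proof. by move=> e0; have := nbhsx_ballx x e e0; rewrite ballEmdist. Qed.

(** The Lipschitz bound in x is uniform in xi, hence continuity in each variable
    yields continuity in the pair. *)
Lemma lip_joint_cts f : continuous ((fun p => f p.1 p.2) : X * K -> R[i]^o).
Proof.
have [L L0 fL] := lip_lipschitz f.
apply/cts_normcP => -[x xi] e e0 /=.
have e2 : 0 < e / 2 by rewrite divr_gt0.
(* [L + 1] because [L] may be 0 *)
have d0 : 0 < e / 2 / (L + 1) by rewrite divr_gt0// ltr_wpDl.
have /cts_normcP/(_ xi _ e2) fx := @ctsC_cts _ _ (f x).
have near2 : \forall p \near (x, xi), normc (f x xi - f x p.2) < e / 2.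
  exists (setT, [set t | normc (f x xi - f x t) < e / 2]) => [|[u v] []//].
  by split=> //; exact: filterT.
have near1 : \forall p \near (x, xi), mdist x p.1 < e / 2 / (L + 1).
  exists ([set t | mdist x t < e / 2 / (L + 1)], setT) => [|[u v] []//].
  by split; [exact: nbhs_mdist_lt | exact: filterT].
near=> p.
have -> : f x xi - f p.1 p.2 = (f x xi - f x p.2) + (f x p.2 - f p.1 p.2).
  by rewrite addrA subrK.
rewrite (le_lt_trans (le_normcD _ _))// [ltRHS](splitr e) ltr_leD//.
  by near: p.
apply: le_trans (fL _ _ _) _.
have : mdist x p.1 < e / 2 / (L + 1) by near: p.
rewrite ltr_pdivlMr ?ltr_wpDl// => /ltW; apply: le_trans.
by rewrite mulrC ler_wpM2l ?mdist_ge0// lerDl.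
Unshelve. all: by end_near. Qed.

Lemma lip_conj f : exists g : lip X K, forall x xi, g x xi = (f x xi)^*%C.
Proof.
have [L L0 fL] := lip_lipschitz f.
apply: (@lip_build _ L) => // [x|x x' xi]; last first.
  by rewrite -rmorphB normc_conj.
apply/cts_normcP => xi e e0.
have /cts_normcP/(_ xi _ e0) := @ctsC_cts _ _ (f x).
by apply: filterS => t; rewrite -rmorphB normc_conj.
Qed.

Lemma compactXK : compact [set: X * K].
Proof.
rewrite -setXTT; apply: compact_setX.
  exact: compact_metric_compact.
exact: compact_hausdorff_compact.
Qed.

Lemma normc_dist_inv (z w : R[i]) : z != 0 -> w != 0 ->
  normc (z^-1 - w^-1) = normc z^-1 * normc w^-1 * normc (z - w).
Proof.
move=> z0 w0; rewrite -(normcN (z - w)) opprB -!Normc.normcM; congr normc.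
by field; rewrite ?z0 ?w0.
Qed.

(** 1 / f is bounded, X * K being compact, and 1 / z - 1 / w is
    (w - z) / (z w). *)
Lemma lip_inv f : (forall x xi, f x xi != 0) ->
  exists g : lip X K, g * f = 1.
Proof.
move=> f0.
have ci x xi e : 0 < e -> \forall p \near (x, xi),
    normc ((f x xi)^-1 - (f p.1 p.2)^-1) < e.
  have : (fun p => (f p.1 p.2)^-1 : R[i]^o) @ (x, xi) -->
      ((f x xi)^-1 : R[i]^o).
    by apply: cvgV => //; exact: (@lip_joint_cts f (x, xi)).
  by move=> /cvgC_distP; exact.
have [B B0 fB] : exists2 B, 0 <= B & forall x xi, normc (f x xi)^-1 <= B.
  have cn : continuous (fun p : X * K => normc (f p.1 p.2)^-1 : R^o).
    move=> [x xi]; apply/cvgrPdist_lt => e e0.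
    apply: filterS (ci x xi e e0) => p; apply: le_lt_trans; exact: normc_dist.
  have /compact_bounded :
      compact ((fun p : X * K => normc (f p.1 p.2)^-1 : R^o) @` setT).
    apply: continuous_compact; first exact: continuous_subspaceT.
    exact: compactXK.
  case=> B [_ /(_ (`|B| + 1))].
  rewrite (le_lt_trans (ler_norm B)) ?ltrDl ?ltr01// => /(_ isT) BP.
  exists (`|B| + 1) => [|x xi]; first by rewrite addr_ge0.
  by apply: le_trans (BP _ _); [exact: ler_norm | exists (x, xi)].
have [L L0 fL] := lip_lipschitz f.
have [|x|x x' xi|g gE] := @lip_build (fun x xi => (f x xi)^-1) (B * B * L).
- by rewrite !mulr_ge0.
- apply/cts_normcP => xi e e0.
  have := ci x xi e e0; case=> -[A C] /= [Ax Cxi] AC.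
  apply: filterS Cxi => t Ct; apply: (AC (x, t)).
  by split=> //; exact: nbhs_singleton Ax.
- rewrite normc_dist_inv// -[leRHS]mulrA ler_pM ?mulr_ge0 ?normc_ge0//.
  by rewrite ler_pM ?normc_ge0.
by exists g; apply: lip_ext => x xi; rewrite lip_mulE lip_oneE gE mulVf.
Qed.

(** The filter generated by the zero sets of the kernel is proper because a
    function without zeros is invertible; complex conjugation makes the family
    of zero sets directed.  A cluster point of that filter is a common zero of
    the kernel, and f - (chi f) 1 lies in the kernel for every f. *)
Lemma character_eval (chi : lip X K -> R[i]) :
  {morph chi : f g / f + g >-> f + g} ->
  (forall a f, chi (a *: f) = a * chi f) ->
  {morph chi : f g / f * g >-> f * g} ->
  chi 1 != 0 -> exists x xi, forall f, chi f = f x xi.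
Proof.
move=> chiD chiZ chiM chi1.
have chi11 : chi 1 = 1.
  by apply: (mulfI chi1); rewrite -chiM !mulr1.
pose Z f : set (X * K) := [set p | f p.1 p.2 = 0].
have ZN0 f : chi f = 0 -> Z f !=set0.
  move=> f0; apply: contrapT => Z0.
  have [x xi|g gf] := @lip_inv f.
    by apply/eqP => fx0; apply: Z0; exists (x, xi).
  by move: chi1; rewrite -gf chiM f0 mulr0 eqxx.
have ZI f g : chi f = 0 -> chi g = 0 ->
    exists2 h, chi h = 0 & Z h `<=` Z f `&` Z g.
  move=> f0 g0; have [f' f'E] := lip_conj f; have [g' g'E] := lip_conj g.
  exists (f' * f + g' * g); first by rewrite chiD !chiM f0 g0 !mulr0 addr0.
  move=> [x xi] Zh; have : (f' * f + g' * g) x xi = 0 by exact: Zh.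
  rewrite lip_addE !lip_mulE f'E g'E.
  move/eqP; rewrite ![_^*%C * _]mulrC paddr_eq0 ?mulcJ_ge0//.
  by rewrite !mulf_eq0 !conjc_eq0 !orbb => /andP[/eqP fx0 /eqP gx0].
pose F : set_system (X * K) :=
  [set A | exists2 f, chi f = 0 & Z f `<=` A].
have chi0 : chi 0 = 0 by rewrite -(scale0r 0) chiZ mul0r.
have FF : ProperFilter F.
  split=> [[f f0 Z0]|]; first by have [p /Z0] := ZN0 f f0.
  split; first by exists 0.
    move=> A B [f f0 fA] [g g0 gB]; have [h h0 hfg] := ZI _ _ f0 g0.
    by exists h => // p /hfg[/fA ? /gB].
  by move=> A B AB [f f0 fA]; exists f => //; exact: subset_trans fA AB.
have [[x xi] [_ clF]] := compactXK FF filterT.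
have ker0 f : chi f = 0 -> f x xi = 0.
  move=> f0; apply: contrapT => /eqP fx0.
  have fx1 : 0 < normc (f x xi) by rewrite normc_gt0.
  have FZ : F (Z f) by exists f.
  have /cts_normcP/(_ (x, xi) _ fx1) /= nf := @lip_joint_cts f.
  have [[y eta] /= [yZ]] := clF _ _ FZ nf.
  by rewrite /= yZ subr0 ltxx.
exists x, xi => f; apply/eqP; rewrite eq_sym -subr_eq0.
have := ker0 (f + (- chi f) *: (1 : lip X K)).
rewrite chiD chiZ chi11 mulr1 subrr => /(_ erefl).
by rewrite lip_addE lip_scaleE lip_oneE mulr1 => ->.
Qed.

End lip_elements.

(** * Uniform boundedness on convex sets of functions *)

Section uniform_boundedness.
Context {R : realType}.

Lemma dist_telescope (u c : nat -> R) :
  (forall n, `|u n.+1 - u n| <= c n - c n.+1) ->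
  forall n m, (n <= m)%N -> `|u m - u n| <= c n - c m.
Proof.
move=> uc n m /subnKC <-; elim: (m - n)%N => [|k IH].
  by rewrite addn0 !subrr normr0.
rewrite addnS -(subrKA (u (n + k)%N)) (le_trans (ler_normD _ _))//.
rewrite -(subrKA (c (n + k)%N) (c n)) addrC lerD//.
Qed.

(** The intervals [u n - c n, u n + c n] are nested; the limit is a point common
    to all of them. *)
Lemma fast_cauchy_lim (u c : nat -> R) : (forall n, 0 <= c n) ->
  (forall n, `|u n.+1 - u n| <= c n - c n.+1) ->
  exists l, forall n, `|l - u n| <= c n.
Proof.
move=> c0 uc.
have lu n m : u n - c n <= u m + c m.
  have [nm|/ltnW mn] := leqP n m.
    have := dist_telescope uc nm; rewrite ler_norml => /andP[+ _].
    by have := c0 m; lra.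
  have := dist_telescope uc mn; rewrite ler_norml => /andP[_].
  by have := c0 n; lra.
pose S := [set u n - c n | n in [set: nat]].
have S0 : S !=set0 by exists (u 0%N - c 0%N), 0%N.
exists (sup S) => n; rewrite ler_norml; apply/andP; split.
  suff : u n - c n <= sup S by lra.
  by apply: ub_le_sup; [exists (u 0%N + c 0%N) => _ [m _ <-] | exists n].
suff : sup S <= u n + c n by lra.
by apply: ge_sup => // _ [m _ <-].
Qed.

Lemma geometric9_small (C e : R) (N : nat) : 0 < e ->
  exists2 m, (N <= m)%N & C * 9^-1 ^+ m <= e.
Proof.
move=> e0; pose k := Num.bound (`|C| / e).
exists (maxn N k); first exact: leq_maxl.
rewrite exprVn ler_pdivrMr ?exprn_gt0//.
have Ck : `|C| < k%:R * e.
  by rewrite -ltr_pdivrMr// archi_boundP// divr_ge0// ltW.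
apply: le_trans (ler_norm C) _; apply: le_trans (ltW Ck) _.
rewrite mulrC ler_wpM2l ?(ltW e0)// -natrX ler_nat.
by apply: leq_trans (leq_maxr N k) _; apply: ltnW; exact: ltn_expl.
Qed.

(** A gliding hump.  Write D n for the oscillation at the n-th bad pair of
    points, which is at most w (p n) on H.  Starting from 0, the n-th step moves a
    fraction t n = 9 ^ -(n + 1) of the way towards either 0 or a function h n
    on which D n attains w (p n).  The two outcomes have D n differing by
    t n * w (p n), so one of them has D n at least t n * w (p n) / 2.  The later
    steps change D n by at most the sum of 2 * t k * w (p n) over k > n, which
    is t n * w (p n) / 4.  The limit belongs to H and its oscillation at the
    n-th pair is at least t n * w (p n) / 4, which contradicts the bound for
    this single function. *)
Theorem uniform_boundedness (Z P : Type) (H : set (Z -> R)) (B : R)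
    (a b : P -> Z) (c w : P -> R) :
  H (fun=> 0) ->
  (forall t g h, 0 <= t <= 1 -> H g -> H h ->
    H (fun z => (1 - t) * g z + t * h z)) ->
  (forall (u : nat -> Z -> R) g, (forall n, H (u n)) ->
    (forall e, 0 < e -> exists n, forall z, `|g z - u n z| <= e) -> H g) ->
  (forall h z, H h -> `|h z| <= B) ->
  (forall p, 0 < c p) ->
  (forall p h, H h -> `|h (a p) - h (b p)| <= w p) ->
  (forall p, exists h, H h /\ w p <= `|h (a p) - h (b p)|) ->
  (forall h, H h -> exists L, forall p, `|h (a p) - h (b p)| <= L * c p) ->
  exists2 L, 0 <= L & forall p, w p <= L * c p.
Proof.
move=> H0 Hconv Hlim HB c0 wub watt ptw.
apply: contrapT => nL.
pose t n : R := 9^-1 ^+ n.+1.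
have t01 n : 0 <= t n <= 1.
  by rewrite exprn_ge0 ?invr_ge0//= exprn_ile1 ?invr_ge0// invf_le1// ler1n.
have t_gt0 n : 0 < t n by rewrite exprn_gt0 ?invr_gt0.
(* the factor 4 / t n turns the lower bound [t n * w (p n) / 4] obtained in
   the limit into [n * c (p n)] *)
have bad n : exists p, 4 * n%:R / t n * c p < w p.
  apply: contrapT => nb; apply: nL; exists (4 * n%:R / t n).
    by rewrite divr_ge0 ?mulr_ge0// ltW.
  by move=> p; rewrite leNgt; apply/negP => wp; apply: nb; exists p.
have [p pP] := choice bad.
have [h hP] := choice (fun n => watt (p n)).
pose D n (f : Z -> R) := f (a (p n)) - f (b (p n)).
(* both moves are convex combinations, so they stay in [H] *)
pose shrink n (f : Z -> R) z := (1 - t n) * f z + t n * 0.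
pose push n (f : Z -> R) z := (1 - t n) * f z + t n * h n z.
pose step n f := if t n * w (p n) / 2 <= `|D n (push n f)| then push n f
                 else shrink n f.
pose fix G n := if n is n'.+1 then step n' (G n') else fun=> 0.
have HG n : H (G n).
  elim: n => [//|n IH] /=; rewrite /step; case: ifP => _; apply: Hconv => //.
  exact: (hP n).1.
(* a common form of both moves, from which the size of a step is read off *)
have stepE n f : exists2 k, H k & forall z, step n f z - f z = t n * (k z - f z).
  rewrite /step; case: ifP => _.
    by exists (h n) => [|z]; [exact: (hP n).1 | rewrite /push; ring].
  by exists (fun=> 0) => // z; rewrite /shrink; ring.
have big n : t n * w (p n) / 2 <= `|D n (G n.+1)|.
  rewrite /= /step; case: ifPn => //; rewrite -ltNge => small.
  have := (hP n).2; rewrite -/(D n (h n)).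
  have -> : D n (shrink n (G n)) = D n (push n (G n)) - t n * D n (h n).
    by rewrite /D /shrink /push; ring.
  rewrite -(ler_pM2l (t_gt0 n)) => wh.
  have := lerB_dist (t n * D n (h n)) (D n (push n (G n))).
  rewrite normrM (gtr0_norm (t_gt0 n)) [`|_ - D n (push _ _)|]distrC.
  by lra.
have tE n : t n = (9^-1 ^+ n - 9^-1 ^+ n.+1) / 8 by rewrite /t exprS; field.
have geo0 C n : 0 <= C -> 0 <= C * 9^-1 ^+ n :> R.
  by move=> C0; rewrite mulr_ge0// exprn_ge0// invr_ge0.
(* [t n] as a telescoping difference, the form [dist_telescope] consumes *)
have geoB C n : C * t n = C / 8 * 9^-1 ^+ n - C / 8 * 9^-1 ^+ n.+1.
  by rewrite tE; field.
have Gstep n z : `|G n.+1 z - G n z| <= 2 * B * t n.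
  have [k Hk /= ->] := stepE n (G n).
  rewrite normrM (gtr0_norm (t_gt0 n)) mulrC ler_wpM2r ?(ltW (t_gt0 n))//.
  rewrite (le_trans (ler_normB _ _))//.
  by have := HB _ z Hk; have := HB _ z (HG n); lra.
have DGstep j n : `|D j (G n.+1) - D j (G n)| <= 2 * w (p j) * t n.
  have [k Hk kE] := stepE n (G n).
  have -> : D j (G n.+1) - D j (G n) = t n * (D j k - D j (G n)).
    transitivity ((step n (G n) (a (p j)) - G n (a (p j)))
                  - (step n (G n) (b (p j)) - G n (b (p j)))).
      by rewrite /D /=; ring.
    by rewrite !kE /D; ring.
  rewrite normrM (gtr0_norm (t_gt0 n)) mulrC ler_wpM2r ?(ltW (t_gt0 n))//.
  rewrite (le_trans (ler_normB _ _))//.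
  by have := wub (p j) _ Hk; have := wub (p j) _ (HG n); rewrite /D; lra.
have lim z : exists l, forall n, `|l - G n z| <= 2 * B / 8 * 9^-1 ^+ n.
  apply: fast_cauchy_lim => n; last by rewrite -geoB Gstep.
  by rewrite geo0// divr_ge0 ?mulr_ge0 ?(le_trans (normr_ge0 _) (HB _ z H0)).
have [g gP] := choice lim.
have Hg : H g.
  apply: (Hlim G) => // e e0.
  have [m _ me] := @geometric9_small (2 * B / 8) e 0 e0.
  by exists m => z; exact: le_trans (gP z m) me.
have Dg n : t n * w (p n) / 4 <= `|D n g|.
  apply/ler_addgt0Pr => e e0.
  have [m nm me] := @geometric9_small (2 * (2 * B / 8)) e n.+1 e0.
  have tail := @dist_telescope (fun m => D n (G m))
    (fun m => 2 * w (p n) / 8 * 9^-1 ^+ m) _ _ _ nm.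
  have {tail} /= tail : `|D n (G m) - D n (G n.+1)| <= 2 * w (p n) / 8 * t n.
    apply: le_trans (tail _) _ => [k|]; first by rewrite -geoB DGstep.
    have wn0 : 0 <= w (p n) := le_trans (normr_ge0 _) (wub (p n) _ H0).
    by rewrite lerBlDr lerDl geo0// divr_ge0 ?mulr_ge0.
  have lim' : `|D n g - D n (G m)| <= e.
    have -> : D n g - D n (G m) = (g (a (p n)) - G m (a (p n)))
        - (g (b (p n)) - G m (b (p n))) by rewrite /D; ring.
    rewrite (le_trans (ler_normB _ _))//.
    have := gP (a (p n)) m; have := gP (b (p n)) m.
    by move: me; rewrite -mulrA; set d := 2 * B / 8 * _; lra.
  have := lerB_dist (D n (G n.+1)) (D n g).
  have := ler_distD (D n (G m)) (D n (G n.+1)) (D n g).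
  rewrite [`|D n (G n.+1) - D n (G m)|]distrC [`|D n (G m) - D n g|]distrC.
  by move: (big n) tail lim'; lra.
have [L gL] := ptw g Hg.
pose n := Num.bound `|L|.
have Ln : L < n%:R by apply: le_lt_trans (ler_norm L) _; exact: archi_boundP.
have := pP n; rewrite ltNge => /negP; apply.
have := le_trans (Dg n) (gL (p n)).
have : L * c (p n) <= n%:R * c (p n) by rewrite ler_wpM2r// ltW.
rewrite -[4 * _ / _ * _]mulrAC ler_pdivlMr//; lra.
Qed.

End uniform_boundedness.

(** * Real-valued elements of the algebra and separation of points *)

Section real_elements.
Context {R : realType} {X : compactMetricType R} {K : compactHausdorffType}.

Lemma lip_of_metric (u : X -> R) :
  (forall x x', `|u x - u x'| <= mdist x x') ->
  exists f : lip X K, forall x xi, f x xi = (u x)%:C%C.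
Proof.
move=> ul; apply: (@lip_build _ _ _ _ 1) => // [x|x x' _].
  by move=> xi; exact: cvg_cst.
by rewrite -rmorphB normc_real mul1r.
Qed.

Lemma lip_of_compact (v : K -> R) : continuous v ->
  exists f : lip X K, forall x xi, f x xi = (v xi)%:C%C.
Proof.
move=> cv; apply: (@lip_build _ _ _ _ 0) => // [x|x x' xi]; last first.
  by rewrite subrr Normc.normc0 mul0r.
apply/cts_normcP => xi e e0; have /cvgrPdist_lt/(_ _ e0) := cv xi.
by apply: filterS => t; rewrite -rmorphB normc_real.
Qed.

Lemma mdist_lipschitz (x0 x x' : X) : `|mdist x0 x - mdist x0 x'| <= mdist x x'.
Proof.
rewrite ler_norml; apply/andP; split.
  by have := metric_triangle x0 x x'; lra.
by have := metric_triangle x0 x' x; rewrite (metric_sym x' x); lra.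
Qed.

Lemma compact_metric_diameter : exists B : R, forall x x' : X, mdist x x' <= B.
Proof.
have [[x0 _]|ne] := pselect (exists x : X, True); last first.
  by exists 0 => x; case: ne; exists x.
have /compact_near_coveringP nc := @compact_metric_compact R X.
have [|B [_ BP]] := nc R +oo%R (fun B x => mdist x0 x <= B).
  move=> x _.
  exists ([set t | mdist x t < 1], [set B | mdist x0 x + 1 <= B]).
    split; first exact: nbhs_mdist_lt.
    by apply: nbhs_pinfty_ge; exact: num_real.
  move=> [t B] /= [xt]; apply: le_trans.
  by apply: le_trans (metric_triangle x0 x t) _; rewrite lerD2l ltW.
exists ((B + 1) + (B + 1)) => x x'; apply: le_trans (metric_triangle x x0 x') _.
have h t : mdist x0 t <= B + 1 by apply: BP => //; rewrite ltrDl.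
by rewrite lerD// metric_sym.
Qed.

Lemma urysohn_point (xi : K) (B : set K) : closed B -> ~ B xi ->
  exists v : K -> R, [/\ continuous v, forall t, 0 <= v t <= 1, v xi = 0 &
                         forall t, B t -> v t = 1].
Proof.
move=> cB nB.
have nK : normal_space K.
  apply: compact_normal; first exact: compact_hausdorff_hausdorff.
  exact: compact_hausdorff_compact.
have cxi : closed [set xi].
  apply: accessible_closed_set1; apply: hausdorff_accessible.
  exact: compact_hausdorff_hausdorff.
have [|v [cv v0 v1 v01]] := @urysohn_ext_itv K R nK [set xi] B 0 1 cxi cB _ ltr01.
  by rewrite -subset0 => t [/= ->].
exists v; split=> // [t||t Bt].
- by have := v01 (v t) (imageT v t); rewrite /= in_itv.
- by apply: v0; exists xi.
- by apply: v1; exists t.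
Qed.

End real_elements.

(** * Metric conditions on the symbols of a homomorphism *)

Section bounds.
Context {R : realType} {X Y : compactMetricType R}
        {K M : compactHausdorffType}.
Variables (D : set (Y * M)) (phi : D -> X) (psi : D -> K).
Variable T : lip X K -> lip Y M.
Hypothesis TE : lip_form phi psi T.

Lemma lip_form_pointwise_bound (f : lip X K) : exists2 L : R, 0 <= L &
  forall z z' : D, (\val z).2 = (\val z').2 ->
    normc (f (phi z) (psi z) - f (phi z') (psi z')) <=
    L * mdist (\val z).1 (\val z').1.
Proof.
have [L L0 TL] := lip_lipschitz (T f).
exists L => // z z' e; have := TL (\val z).1 (\val z').1 (\val z).2.
by rewrite {2}e (TE f).1 (TE f).1.
Qed.

(** Uniform boundedness for the 1-Lipschitz functions on X: the distance to
    phi z attains the largest oscillation between phi z and phi z'. *)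
Lemma lip_form_equilipschitz : equilipschitz phi.
Proof.
pose P := {q : D * D | (\val q.1).2 = (\val q.2).2 /\
                       (\val q.1).1 <> (\val q.2).1}.
have [B XB] := @compact_metric_diameter R X.
(* the bound by the diameter keeps [H] uniformly bounded without excluding
   the distance functions; [B] can be negative if [X] is empty *)
pose H : set (X -> R) := [set u | (forall x, `|u x| <= Num.max 0 B) /\
  forall x x', `|u x - u x'| <= mdist x x'].
have [||||||||L L0 LP] := @uniform_boundedness R X P H (Num.max 0 B)
  (fun q => phi (sval q).1) (fun q => phi (sval q).2)
  (fun q => mdist (\val (sval q).1).1 (\val (sval q).2).1)
  (fun q => mdist (phi (sval q).1) (phi (sval q).2)).
- by split=> [x|x x']; rewrite ?subrr normr0 ?mdist_ge0// le_max lexx.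
- move=> t g h /andP[t0 t1] [gB gl] [hB hl]; split=> [x|x x'].
    apply: le_trans (ler_normD _ _) _.
    rewrite !normrM (ger0_norm t0) ger0_norm ?subr_ge0//.
    have -> : Num.max 0 B = (1 - t) * Num.max 0 B + t * Num.max 0 B by ring.
    by rewrite lerD// ler_wpM2l// subr_ge0.
  have -> : (1 - t) * g x + t * h x - ((1 - t) * g x' + t * h x') =
    (1 - t) * (g x - g x') + t * (h x - h x') by ring.
  apply: le_trans (ler_normD _ _) _.
  rewrite !normrM (ger0_norm t0) ger0_norm ?subr_ge0//.
  have -> : mdist x x' = (1 - t) * mdist x x' + t * mdist x x' by ring.
  by rewrite lerD// ler_wpM2l// subr_ge0.
- move=> u g uH gu; split=> [x|x x']; apply/ler_addgt0Pr => e e0.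
    have [n /(_ x)] := gu e e0; have := (uH n).1 x.
    have := lerB_dist (g x) (u n x); lra.
  have e2 : 0 < e / 2 by lra.
  have [n nP] := gu _ e2; have := (uH n).2 x x'; have := nP x; have := nP x'.
  by rewrite !ler_norml; lra.
- by move=> h z [].
- by move=> [q [q1 q2]] /=; rewrite mdist_gt0; exact/eqP.
- by move=> q h [_]; exact.
- move=> q; exists (mdist (phi (sval q).1)); split; last first.
    by rewrite mdistxx sub0r normrN ger0_norm ?mdist_ge0.
  split=> [x|x x']; last exact: mdist_lipschitz.
  by rewrite ger0_norm ?mdist_ge0// le_max XB orbT.
- move=> u [_ ul]; have [f fE] := @lip_of_metric R X K u ul.
  have [L L0 fL] := lip_form_pointwise_bound f.
  exists L => -[[z z'] [q1 q2]] /=.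
  by have := fL z z' q1; rewrite !fE -rmorphB normc_real.
exists L => // z z' e n; rewrite ler_pdivrMr; last by rewrite mdist_gt0; exact/eqP.
exact: (LP (exist _ (z, z') (conj e n))).
Qed.

(** Uniform boundedness for the continuous functions from K to [0, 1]: Urysohn
    functions attain oscillation 1 between any two distinct values of psi,
    so the distance of the corresponding y is bounded below. *)
Lemma lip_form_psi_locally_constant : exists2 r : R, 0 < r &
  forall z z' : D, (\val z).2 = (\val z').2 ->
    mdist (\val z).1 (\val z').1 < r -> psi z = psi z'.
Proof.
pose P := {q : D * D | (\val q.1).2 = (\val q.2).2 /\ psi q.1 <> psi q.2}.
pose H : set (K -> R) :=
  [set v : K -> R | continuous v /\ forall t : K, 0 <= v t <= 1].
have [||||||||L L0 LP] := @uniform_boundedness R K P H 1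
  (fun q => psi (sval q).1) (fun q => psi (sval q).2)
  (fun q => mdist (\val (sval q).1).1 (\val (sval q).2).1) (fun=> 1).
- by split=> [x|x]; [exact: cvg_cst | rewrite lexx ler01].
- move=> t g h /andP[t0 t1] [cg g01] [ch h01]; split=> x.
    by apply: cvgD; (apply: cvgM; [exact: cvg_cst|]); [exact: cg | exact: ch].
  have /andP[g0 g1] := g01 x; have /andP[h0 h1] := h01 x.
  by apply/andP; split; nra.
- move=> u g uH gu; split=> x; last first.
    apply/andP; split; apply/ler_addgt0Pr => e e0;
      have [n /(_ x)] := gu e e0; have /andP[] := (uH n).2 x;
      rewrite ler_norml; lra.
  apply/cvgrPdist_lt => e e0; have e3 : 0 < e / 3 by lra.
  have [n nP] := gu _ e3; have /cvgrPdist_lt/(_ _ e3) := (uH n).1 x.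
  apply: filterS => t; have := nP x; have := nP t.
  by rewrite !ler_norml !ltr_norml; lra.
- by move=> h z [_ /(_ z)/andP[h0 h1]]; rewrite ger0_norm.
- move=> [[z z'] [q1 q2]] /=; rewrite mdist_gt0; apply/eqP => e; apply: q2.
  congr psi; apply: val_inj; move: q1 e => /=.
  by case: (\val z) (\val z') => ? ? [? ?] /= -> ->.
- move=> q h [_ h01].
  have := h01 (psi (sval q).1); have := h01 (psi (sval q).2).
  by rewrite ler_norml; lra.
- move=> [[z z'] [q1 q2]] /=.
  have [||v [cv v01 v0 v1]] := @urysohn_point R K (psi z) [set psi z'].
  + apply: accessible_closed_set1; apply: hausdorff_accessible.
    exact: compact_hausdorff_hausdorff.
  + by move=> /= e; exact: q2.
  by exists v; split=> //; rewrite v0 v1// sub0r normrN normr1.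
- move=> v [cv _]; have [f fE] := @lip_of_compact R X K v cv.
  have [L L0 fL] := lip_form_pointwise_bound f.
  exists L => -[[z z'] [q1 q2]] /=.
  by have := fL z z' q1; rewrite !fE -rmorphB normc_real.
exists (L + 1)^-1; first by rewrite invr_gt0; lra.
move=> z z' e dr; apply: contrapT => n.
have /= := LP (exist _ (z, z') (conj e n)).
have L1 : 0 < L + 1 by lra.
move: dr; rewrite -[_^-1]mul1r ltr_pdivlMr//.
by have := mdist_ge0 (\val z).1 (\val z').1; nra.
Qed.

End bounds.

(** * Continuity and the form of a homomorphism *)

Section form.
Context {R : realType} {X Y : compactMetricType R}
        {K M : compactHausdorffType}.
Implicit Types (D : set (Y * M)) (T : lip X K -> lip Y M).

Lemma val_onto D p : D p -> exists z : D, \val z = p.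
Proof. by move=> Dp; exists (exist _ p (mem_set Dp)). Qed.

Lemma lip_form_near D (phi : D -> X) (psi : D -> K) T (f : lip X K) (z : D)
    (e : R) :
  lip_form phi psi T -> 0 < e ->
  \forall z' \near z, normc (f (phi z) (psi z) - f (phi z') (psi z')) < e.
Proof.
move=> TE e0.
have /cts_normcP/(_ (\val z) _ e0) Tz := @lip_joint_cts _ _ _ (T f).
have := @initial_continuous D _ set_val z _ Tz; rewrite nbhs_simpl /=.
apply: filterS => z' /=.
by rewrite !(TE f).1.
Qed.

(** The distance to phi z, resp. a function that is 0 at psi z and 1 outside a
    neighbourhood of it, becomes continuous after composition with phi,
    resp. psi: the composition is a value of T. *)
Lemma lip_form_continuous D (phi : D -> X) (psi : D -> K) T :
  lip_form phi psi T -> continuous phi /\ continuous psi.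
Proof.
move=> TE; split=> z.
  move=> U /nbhs_ballP[e /= e0]; rewrite ballEmdist => eU.
  have [f fE] := @lip_of_metric R X K (mdist (phi z)) (mdist_lipschitz (phi z)).
  apply: filterS (lip_form_near f z TE e0) => z' fz'.
  apply: eU => /=; move: fz'.
  by rewrite !fE -rmorphB normc_real mdistxx sub0r normrN ger0_norm ?mdist_ge0.
move=> U; rewrite nbhsE => -[V [oV Vz] VU].
have [||v [cv _ v0 v1]] := @urysohn_point R K (psi z) (~` V).
- by rewrite closedC.
- by move=> /=; exact.
have [f fE] := @lip_of_compact R X K v cv.
apply: filterS (lip_form_near f z TE ltr01) => z'.
rewrite !fE v0 -rmorphB normc_real sub0r normrN => v'; apply: VU.
by apply: contrapT => /v1 v'1; move: v'; rewrite v'1 normr1 ltxx.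
Qed.

(** D is where the idempotent T 1 equals 1; there f |-> T f y eta is a nonzero
    character.  Elsewhere T f = T f * T 1 vanishes. *)
Lemma lip_hom_form T : lip_hom T ->
  exists (D : set (Y * M)) (phi : D -> X) (psi : D -> K),
    clopen D /\ lip_form phi psi T.
Proof.
move=> [TD TZ TM].
pose D : set (Y * M) := [set p | T 1 p.1 p.2 = 1].
have T1 y eta : T 1 y eta = 0 \/ T 1 y eta = 1.
  have := TM 1 1; rewrite mulr1 => /(congr1 (fun f : lip Y M => f y eta)).
  rewrite lip_mulE => /eqP; rewrite -subr_eq0 -{1}[T 1 y eta]mulr1 -mulrBr.
  rewrite mulf_eq0 subr_eq0.
  by move=> /orP[] /eqP; [left|right].
have nearT1 p : \forall q \near p, T 1 q.1 q.2 = T 1 p.1 p.2.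
  have /cts_normcP/(_ p _ ltr01) := @lip_joint_cts _ _ _ (T 1).
  apply: filterS => q.
  have [->|->] := T1 p.1 p.2; have [->|->] := T1 q.1 q.2 => //.
    by rewrite sub0r normcN Normc.normc1 ltxx.
  by rewrite subr0 Normc.normc1 ltxx.
have ev z : D z -> exists p : X * K, forall f, T f z.1 z.2 = f p.1 p.2.
  move=> Dz.
  have [f g|a f|f g||x [xi E]] := @character_eval R X K (fun f => T f z.1 z.2).
  - by rewrite TD.
  - by rewrite TZ.
  - by rewrite TM.
  - by rewrite Dz oner_neq0.
  by exists (x, xi).
have [P PE] := choice (fun z : D => ev (\val z) (set_valP z)).
exists D, (fun z => (P z).1), (fun z => (P z).2); split.
  split; [rewrite openE | rewrite -[D]setCK closedC openE] => p Dp.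
    by apply: filterS (nearT1 p) => q; rewrite /D /= => ->.
  by apply: filterS (nearT1 p) => q; rewrite /D /= => ->.
move=> f; split=> [z|y eta nD]; first exact: PE.
have [T10|//] := T1 y eta.
by rewrite -[f]mulr1 TM lip_mulE T10 mulr0.
Qed.

(** From right to left, the pieces over eta are the level sets of psi(., eta).
    They are open by the hypothesis on r, so compactness of the section of D
    leaves only finitely many of them. *)
Lemma piecewise_constantP D (psi : D -> K) : clopen D ->
  piecewise_constant psi <->
  exists2 r : R, 0 < r & forall z z' : D, (\val z).2 = (\val z').2 ->
    mdist (\val z).1 (\val z').1 < r -> psi z = psi z'.
Proof.
move=> [oD cD]; split=> [[r r0 rP]|[r r0 rP]]; exists r => //.
  move=> z z' e dr; have [n [V [DV _ _ cV dV]]] := rP (\val z).2.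
  have inV (u : D) : (\val u).2 = (\val z).2 -> exists i, V i (\val u).1.
    move=> ue; have : [set y | D (y, (\val z).2)] (\val u).1.
      by rewrite /= -ue -surjective_pairing; exact: set_valP.
    by rewrite DV => -[i _ Vi]; exists i.
  have [i Vi] := inV z erefl; have [j Vj] := inV z' (esym e).
  have [ij|ij] := eqVneq i j; first by apply: (cV i) => //; rewrite ij.
  suff : ((r%:E : \bar R) <= (mdist (\val z).1 (\val z').1)%:E)%E.
    by rewrite lee_fin leNgt dr.
  apply: le_trans (dV i j ij) _; apply: ereal_inf_lbound.
  by exists ((\val z).1, (\val z').1).
move=> eta.
pose L xi : set Y := [set y | exists2 z : D, \val z = (y, eta) & psi z = xi].
have nearD (A : set (Y * M)) y :
    open A -> A (y, eta) -> \forall y' \near y, A (y', eta).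
  move=> oA Ay.
  have [[U V] /= [Uy Veta] UV] : nbhs (y, eta) A by exact: open_nbhs_nbhs.
  apply: filterS Uy => y' Uy'; apply: UV.
  by split=> //; exact: nbhs_singleton Veta.
have nearL y xi : L xi y -> \forall y' \near y, L xi y'.
  move=> [z zy zxi]; have Dy : D (y, eta) by rewrite -zy; exact: set_valP.
  near=> y'.
  have [z' z'y] : exists z' : D, \val z' = (y', eta).
    by apply: val_onto; near: y'; exact: nearD.
  exists z' => //; rewrite -zxi; apply/esym/rP; rewrite zy z'y//=.
  by near: y'; exact: nbhs_mdist_lt.
have [s sP] : exists s : seq K,
    forall y, D (y, eta) -> exists2 xi, xi \in s & L xi y.
  (* finite lists of values ordered by inclusion: a list good enough near each
     point can be chosen good enough everywhere *)
  pose F : set_system (seq K) :=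
    [set A : set (seq K) | exists s0 : seq K,
      forall s : seq K, {subset s0 <= s} -> A s].
  have FF : Filter F.
    split; first by exists [::].
      move=> A B [s As] [t Bt]; exists (s ++ t) => u su.
      by split; [apply: As|apply: Bt] => x xs; apply: su; rewrite mem_cat xs ?orbT.
    by move=> A B AB [s As]; exists s => t st; apply/AB/As.
  have : compact [set y | D (y, eta)].
    apply: (@subclosed_compact _ _ [set: Y]) => //; last first.
      exact: compact_metric_compact.
    rewrite -[X in closed X]setCK closedC openE => y nDy.
    by apply: (@nearD (~` D)) => //; rewrite openC.
  move=> /compact_near_coveringP nc.
  have [|s0 s0P] := nc _ F (fun s y => exists2 xi, xi \in s & L xi y) FF.
    move=> y /= /val_onto[z zy].
    exists (L (psi z), [set s : seq K | psi z \in s]) => /=.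
      split; first by apply: nearL; exists z.
      by exists [:: psi z] => s; apply; rewrite mem_head.
    by move=> [y' s] /= [Ly' zs]; exists (psi z).
  by exists s0 => y Dy; exact: s0P.
pose t := undup s.
exists (size t), (fun i => L (tnth (in_tuple t) i)).
have LI xi xi' y y' : L xi y -> L xi' y' -> mdist y y' < r -> xi = xi'.
  by move=> [z zy <-] [z' z'y <-] dr; apply: rP; rewrite zy z'y.
have tI i j : i != j -> tnth (in_tuple t) i <> tnth (in_tuple t) j.
  have xi0 := tnth (in_tuple t) i.
  move=> + /eqP; rewrite !(tnth_nth xi0) /= nth_uniq ?undup_uniq//.
  by move=> /negP.
split.
- apply/seteqP; split=> [y /sP[xi]|y [i _ [z zy _]]]; last first.
    by rewrite /= -zy; exact: set_valP.
  rewrite -mem_undup -/t => /(tnthP (in_tuple t))[i ->] Li.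
  by exists i.
- move=> i; split; first by rewrite openE => y; exact: nearL.
  rewrite -[L _]setCK closedC openE => y nLy.
  have [Dy|nDy] := pselect (D (y, eta)); last first.
    have : \forall y' \near y, (~` D) (y', eta).
      by apply: nearD => //; rewrite openC.
    apply: filterS => y' nD' [z zy' _].
    by apply: nD'; rewrite -zy'; exact: set_valP.
  have [z zy] := val_onto Dy.
  have : \forall y' \near y, L (psi z) y' by apply: nearL; exists z.
  apply: filter_app.
  apply: filterS (nbhs_mdist_lt y r0) => y' yy' Lz [z' z'y' e].
  by apply: nLy; exists z => //; rewrite -e; apply: rP; rewrite zy z'y'.
- move=> i j /tI ij; apply/seteqP; split=> // y [Li Lj]; apply: ij.
  by apply: LI Li Lj _; rewrite mdistxx.
- move=> i z z' ez ez' [u uz <-] [u' uz' e].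
  have -> : z = u by apply: val_inj; rewrite uz -ez -surjective_pairing.
  by have -> : z' = u' by apply: val_inj; rewrite uz' -ez' -surjective_pairing.
- move=> i j /tI ij; apply: le_ereal_inf_tmp => _ [[y y'] [/= Ly Ly'] <-].
  by rewrite lee_fin leNgt; apply/negP => dr; apply: ij; exact: LI Ly Ly' dr.
Unshelve. all: by end_near. Qed.

(** * Composition operators *)

(** Membership in D is locally constant on the compact space Y * M, hence
    constant at a uniform scale in y. *)
Lemma clopen_uniform D : clopen D -> exists2 d : R, 0 < d &
  forall y y' eta, mdist y y' < d -> D (y, eta) -> D (y', eta).
Proof.
move=> [oD cD].
have /compact_near_coveringP nc := @compactXK R Y M.
pose good (d : R) (p : Y * M) :=
  forall y', mdist p.1 y' < d -> D p -> D (y', p.2).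
have [[y0 eta0] _|d [/= d0 dP]] := nc _ (0 : R)^'+ good _.
  have [Dp|nDp] := pselect (D (y0, eta0)); last first.
    exists (~` D, setT) => [|[p d] [/= nD _] y' _ //].
    split; last exact: filterT.
    by apply: open_nbhs_nbhs; split=> //; rewrite openC.
  have [[U V] /= [/nbhs_ballP[e /= e0]]] : nbhs (y0, eta0) D.
    exact: open_nbhs_nbhs.
  rewrite ballEmdist => Ue Veta UV.
  have e2 : 0 < e / 2 by rewrite divr_gt0.
  exists ([set y | mdist y0 y < e / 2] `*` V, [set d | d < e / 2]).
    split; last exact: nbhs_right_lt.
    exists ([set y | mdist y0 y < e / 2], V) => //.
    by split=> //; exact: nbhs_mdist_lt.
  move=> [[y eta] d] [/= [ye Ve] de] y' /= yd _.
  apply: UV; split=> //=; apply: Ue => /=.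
  by have := metric_triangle y0 y y'; lra.
(* [dP] speaks of the radii in the punctured ball of radius [d] *)
exists (d / 2); first by rewrite divr_gt0.
move=> y y' eta yd; apply: (dP (d / 2)) => //=; last by rewrite divr_gt0.
by rewrite sub0r normrN gtr0_norm ?divr_gt0// ltr_pdivrMr// mulr2n; lra.
Qed.

Definition extend_by_zero D (g : D -> R[i]) (p : Y * M) : R[i] :=
  if pselect (D p) is left Dp then g (exist _ p (mem_set Dp)) else 0.

Lemma extend_by_zero_in D (g : D -> R[i]) (z : D) :
  extend_by_zero g (\val z) = g z.
Proof.
rewrite /extend_by_zero; case: pselect => [Dz|]; last by case; exact: set_valP.
by congr g; exact: val_inj.
Qed.

Lemma extend_by_zero_out D (g : D -> R[i]) p : ~ D p -> extend_by_zero g p = 0.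
Proof. by rewrite /extend_by_zero; case: pselect. Qed.

Lemma extend_by_zero_continuous D (g : D -> R[i]) : clopen D ->
  continuous (g : D -> R[i]^o) ->
  continuous (extend_by_zero g : Y * M -> R[i]^o).
Proof.
move=> [oD cD] /cts_normcP cg; apply/cts_normcP => p e e0.
have [Dp|nDp] := pselect (D p); last first.
  have : nbhs p (~` D) by apply: open_nbhs_nbhs; split=> //; rewrite openC.
  by apply: filterS => q nDq; rewrite !extend_by_zero_out// subrr Normc.normc0.
have [z <-] := val_onto Dp.
have [_ [/= [W oW <-] Wz] WU] := cg z e e0.
have : nbhs (\val z) (W `&` D).
  by apply: open_nbhs_nbhs; split; [exact: openI | split=> //; exact: set_valP].
apply: filterS => q [Wq Dq].
have [z' qE] := val_onto Dq.
rewrite -qE !extend_by_zero_in; apply: WU.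
by rewrite /= -[set_val z']/(\val z') qE.
Qed.

(** At distances below both the scale r of psi and the scale d of D, the points
    (y, eta) and (y', eta) are both outside D, or both inside with the same
    value of psi, so that the constants of f and phi multiply; at larger
    distances the bound 2 sup |f| suffices. *)
Lemma lip_form_exists D (phi : D -> X) (psi : D -> K) : clopen D ->
  continuous phi -> continuous psi ->
  equilipschitz phi -> piecewise_constant psi ->
  exists T, lip_form phi psi T.
Proof.
move=> clD cphi cpsi [L L0 phiL] /(piecewise_constantP _ clD)[r r0 psir].
have [d d0 Dd] := clopen_uniform clD.
have phiL' (z z' : D) : (\val z).2 = (\val z').2 ->
    mdist (phi z) (phi z') <= L * mdist (\val z).1 (\val z').1.
  move=> e; have [e1|n] := pselect ((\val z).1 = (\val z').1).
    have -> : z = z'.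
      apply: val_inj.
      by rewrite [LHS]surjective_pairing [RHS]surjective_pairing e e1.
    by rewrite !mdistxx mulr0.
  rewrite -ler_pdivrMr; last by rewrite mdist_gt0; exact/eqP.
  exact: phiL.
suff /choice[T TP] : forall f : lip X K, exists g : lip Y M,
    forall y eta, g y eta = extend_by_zero (fun z => f (phi z) (psi z)) (y, eta).
  exists T => f; split=> [z|y eta nD]; rewrite TP; last exact: extend_by_zero_out.
  by rewrite -surjective_pairing extend_by_zero_in.
move=> f; have [Lf Lf0 fL] := lip_lipschitz f; have [B B0 fB] := lip_bound f.
set g := extend_by_zero _.
have cg : continuous (g : Y * M -> R[i]^o).
  apply: extend_by_zero_continuous => //; apply/cts_normcP => z e e0.
  have /cts_normcP/(_ (phi z, psi z) _ e0) := @lip_joint_cts _ _ _ f.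
  case=> -[U V] /= [/cphi Uz /cpsi Vz] UV.
  have /filterI/(_ Vz) : nbhs z (phi @^-1` U) by exact: Uz.
  by apply: filterS => z' UVz'; exact: (UV (phi z', psi z')).
have gB p : normc (g p) <= B.
  rewrite /g /extend_by_zero; case: pselect => [Dp|nDp]; first exact: fB.
  by rewrite Normc.normc0.
have s0 : 0 < Num.min r d by rewrite lt_min r0.
apply: (@lip_build _ _ _ (fun y eta => g (y, eta))
  (Lf * L + (B + B) / Num.min r d)).
- by apply: addr_ge0; [exact: mulr_ge0 | rewrite divr_ge0 ?addr_ge0// ltW].
- move=> y; apply/cts_normcP => eta e e0; have /cts_normcP/(_ (y, eta) _ e0) := cg.
  case=> -[U V] /= [Uy Veta] UV; apply: filterS Veta => t Vt.
  by apply: (UV (y, t)); split=> //; exact: nbhs_singleton Uy.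
move=> y y' eta; rewrite mulrDl.
have LL : 0 <= Lf * L * mdist y y' by rewrite !mulr_ge0// mdist_ge0.
have BB : 0 <= (B + B) / Num.min r d * mdist y y'.
  by rewrite mulr_ge0 ?mdist_ge0// divr_ge0 ?addr_ge0// ltW.
have [far|near] := leP (Num.min r d) (mdist y y').
  apply: le_trans (le_normcD _ _) _; rewrite normcN.
  apply: (@le_trans _ _ (B + B)); first by rewrite lerD.
  rewrite -[leLHS]add0r lerD// -mulrA ler_peMr ?addr_ge0//.
  by rewrite mulrC ler_pdivlMr// mul1r.
move: near; rewrite lt_min => /andP[yr yd].
rewrite -[leLHS]addr0 lerD//.
have [Dy|nDy] := pselect (D (y, eta)); last first.
  rewrite /g !extend_by_zero_out ?subrr ?Normc.normc0// => Dy'; apply: nDy.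
  by apply: Dd Dy'; rewrite metric_sym.
have Dy' := Dd _ _ _ yd Dy.
have [z zE] := val_onto Dy.
have [z' zE'] := val_onto Dy'.
rewrite /g -zE -zE' !extend_by_zero_in -(psir z z') ?zE ?zE'//.
apply: le_trans (fL _ _ _) _; rewrite -mulrA ler_wpM2l//.
by have := phiL' z z'; rewrite zE zE'; exact.
Qed.

Lemma lip_form_eq D (phi : D -> X) (psi : D -> K) T (f : lip X K) (g : lip Y M) :
  lip_form phi psi T ->
  (forall z : D, g (\val z).1 (\val z).2 = f (phi z) (psi z)) ->
  (forall y eta, ~ D (y, eta) -> g y eta = 0) -> T f = g.
Proof.
move=> TE gD gN; apply: lip_ext => y eta.
have [Dy|nD] := pselect (D (y, eta)); last by rewrite (TE f).2// gN.
have [z zE] := val_onto Dy.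
by have := gD z; rewrite -(TE f).1 zE.
Qed.

Lemma lip_form_hom D (phi : D -> X) (psi : D -> K) T :
  lip_form phi psi T -> lip_hom T.
Proof.
move=> TE; split=> [f g|a f|f g]; apply: (lip_form_eq TE) => [z|y eta nD].
- by rewrite !lip_addE !(TE _).1.
- by rewrite lip_addE !(TE _).2// addr0.
- by rewrite !lip_scaleE !(TE _).1.
- by rewrite lip_scaleE !(TE _).2// mulr0.
- by rewrite !lip_mulE !(TE _).1.
- by rewrite lip_mulE !(TE _).2// mulr0.
Qed.

Lemma lip_form_unital D (phi : D -> X) (psi : D -> K) T :
  lip_form phi psi T -> (lip_unital T <-> D = setT).
Proof.
move=> TE; split=> [T1|DT]; last first.
  apply: (lip_form_eq TE) => [z|y eta []]; first by rewrite !lip_oneE.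
  by rewrite DT.
apply/seteqP; split=> // -[y eta] _; apply: contrapT => /((TE 1).2 y eta).
by rewrite T1 lip_oneE => /eqP; rewrite oner_eq0.
Qed.

End form.

Theorem theorem1 (R : realType) (X Y : compactMetricType R)
    (K M : compactHausdorffType) :
  (forall T : lip X K -> lip Y M, lip_hom T ->
     exists (D : set (Y * M)) (phi : D -> X) (psi : D -> K),
       [/\ clopen D, continuous phi /\ continuous psi,
           equilipschitz phi, piecewise_constant psi &
           lip_form phi psi T]) /\
  (forall (D : set (Y * M)) (phi : D -> X) (psi : D -> K),
     clopen D -> continuous phi -> continuous psi ->
     equilipschitz phi -> piecewise_constant psi ->
     (exists T : lip X K -> lip Y M, lip_form phi psi T) /\
     (forall T : lip X K -> lip Y M, lip_form phi psi T ->
        lip_hom T /\ (lip_unital T <-> D = [set: Y * M]))).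
Proof.
split=> [T /lip_hom_form[D [phi [psi [clD TE]]]]|
         D phi psi clD cphi cpsi lphi pcpsi].
  exists D, phi, psi; split=> //.
  - exact: lip_form_continuous TE.
  - exact: lip_form_equilipschitz TE.
  - apply/piecewise_constantP => //.
    exact: lip_form_psi_locally_constant TE.
split; first exact: lip_form_exists.
by move=> T TE; split; [exact: lip_form_hom TE | exact: lip_form_unital TE].
Qed.
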